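(* Let $W:\mathcal X\to\mathcal Y$ be a discrete memoryless channel and, for an input distribution $p$ on $\mathcal X$, let $I(p)$ be the mutual information between the input and the output of the channel when the input distribution is $p$. Let $\delta\in(0,1/8)$ and let $p$ and $p^*$ be input distributions on $\mathcal X$ such that $$\frac12\sum_{x\in\mathcal X}|p^*(x)-p(x)|<\delta.$$ Then $$|I(p^* )-I(p)|<3\delta\log|\mathcal Y|+h_2(\delta)$$ and $$|I(p^* )-I(p)|<7\delta\log|\mathcal X|+h_2(\delta)+h_2(4\delta).$$
   Context: A discrete memoryless channel $W:\mathcal X\to\mathcal Y$ has finite input alphabet $\mathcal X$, finite output alphabet $\mathcal Y$, and transition probabilities $W(y\mid x)$. All logarithms (including those in the mutual information) are in base 2, and $h_2(x)=-x\log x-(1-x)\log(1-x)$ is the binary entropy function. *)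

(* Defs.v *)
From HB Require Import structures.
From mathcomp Require Import all_boot all_order all_algebra.
From mathcomp Require Import boolp classical_sets reals topology normedtype sequences exp.

Set Implicit Arguments.
Unset Strict Implicit.
Unset Printing Implicit Defensive.

Import Order.TTheory GRing.Theory Num.Theory.

Local Open Scope ring_scope.

Record distribution (R : realType) (A : finType) := Distribution {
  prob :> A -> R ;
  prob_ge0 : forall a, 0 <= prob a ;
  prob_sum1 : \sum_(a : A) prob a = 1
}.

(* [W x y] is the transition probability W(y|x). *)
Definition channel (R : realType) (X Y : finType) := X -> distribution R Y.

(* [ln 0 = 0] in the library; below, [log2 0] only ever occurs multiplied by
   0, so that this is the usual convention 0 log 0 = 0. *)
Definition log2 (R : realType) (x : R) : R := ln x / ln 2.

Definition h2 (R : realType) (x : R) : R :=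
  - x * log2 x - (1 - x) * log2 (1 - x).

Section Joint.
Variables (R : realType) (X Y : finType).

Definition marginal1 (P : distribution R (X * Y)%type) (x : X) : R :=
  \sum_(y : Y) P (x, y).

Definition marginal2 (P : distribution R (X * Y)%type) (y : Y) : R :=
  \sum_(x : X) P (x, y).

(* If [P (x, y) > 0], both marginals are positive, so the quotient is genuine
   in every term with a nonzero weight. *)
Definition mutual_information (P : distribution R (X * Y)%type) : R :=
  \sum_(x : X) \sum_(y : Y)
    P (x, y) * log2 (P (x, y) / (marginal1 P x * marginal2 P y)).

Variables (W : channel R X Y) (p : distribution R X).

Let joint_prob (xy : X * Y) : R := p xy.1 * W xy.1 xy.2.

Lemma joint_prob_ge0 xy : 0 <= joint_prob xy.
Proof. by rewrite mulr_ge0 ?prob_ge0. Qed.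

Lemma joint_prob_sum1 : \sum_(xy : X * Y) joint_prob xy = 1.
Proof.
rewrite -(pair_bigA _ (fun x y => p x * W x y)) /= -(prob_sum1 p).
by apply: eq_bigr => x _; rewrite -mulr_sumr prob_sum1 mulr1.
Qed.

Definition input_output_distribution : distribution R (X * Y)%type :=
  Distribution joint_prob_ge0 joint_prob_sum1.

Definition channel_information : R :=
  mutual_information input_output_distribution.

End Joint.

(* Main.v *)
Require Import Defs.
From mathcomp Require Import all_boot all_order all_algebra.
From mathcomp Require Import reals.
From mathcomp Require Import exp.
From mathcomp Require Import ring lra.
Import Order.TTheory GRing.Theory Num.Theory.
Local Open Scope ring_scope.

(** Let [m = min(p, p')], [p = m + a] and [p' = m + b], where [p' = pstar]; then
    [a] and [b] have mass [t], the total variation distance.  Extended to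
    unnormalised inputs, the mutual information [I] satisfies
    [I(m) + I(a) - h(t) <= I(m + a) <= I(m) + I(a)], and on inputs of mass [t]
    it lies between [- t log t] and [t log N - t log t], where [N] is [|X|] or
    [|Y|].  Hence [|I(p') - I(p)| <= t log N + h(t)], and [h] is increasing on
    [[0, 1/2]]. *)

(** * Logarithmic inequalities and binary entropy, in natural logarithms *)

Section LogSum.
Variable R : realType.
Implicit Types x y c : R.

Lemma ln_ge1BV x : 0 < x -> 1 - x^-1 <= ln x.
Proof.
move=> x0; have x1 : 0 < x^-1 by rewrite invr_gt0.
have : ln (1 + (x^-1 - 1)) <= x^-1 - 1 by apply: le_ln1Dx; lra.
rewrite addrCA subrr addr0 lnV ?posrE //; lra.
Qed.

(** One term of the log-sum inequality, linearised: for positive [x] this is [x] times the tangent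
    bound [ln z >= 1 - 1 / z] at [z = x / (c * y)]. *)
Lemma mul_ln_div_ge x y c : 0 < c -> 0 <= x -> 0 <= y -> (0 < x -> 0 < y) ->
  x - c * y <= x * ln (x / y) - x * ln c.
Proof.
move=> c0; rewrite le_eqVlt => /orP[/eqP<- y0 _|x0 _ /(_ x0) y0].
  by rewrite !mul0r subrr sub0r oppr_le0 mulr_ge0 // ltW.
have cy0 : 0 < c * y by rewrite mulr_gt0.
have -> : x - c * y = x * (1 - (x / (c * y))^-1).
  by field; rewrite !gt_eqF.
rewrite -mulrBr ler_pM2l // (_ : ln (x / y) - ln c = ln (x / (c * y))).
  by apply: ln_ge1BV; rewrite divr_gt0.
rewrite !ln_div ?lnM ?posrE //; ring.
Qed.

Lemma log_sum_ineq (I : finType) (f g : I -> R) :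
  (forall i, 0 <= f i) -> (forall i, 0 <= g i) ->
  (forall i, 0 < f i -> 0 < g i) ->
  (\sum_i f i) * ln ((\sum_i f i) / (\sum_i g i)) <=
  \sum_i f i * ln (f i / g i).
Proof.
move=> f0 g0 fg.
have [F0|F0] := eqVneq (\sum_i f i) 0.
  rewrite F0 mul0r big1 // => i _.
  by rewrite (psumr_eq0P _ F0) ?mul0r.
have Fpos : 0 < \sum_i f i by rewrite lt_neqAle eq_sym F0 sumr_ge0.
have Gpos : 0 < \sum_i g i.
  rewrite lt_neqAle sumr_ge0 // andbT; apply/eqP => G0.
  move/eqP: F0; apply; apply: big1 => i _.
  apply/eqP; rewrite eq_le f0 andbT leNgt; apply/negP => /fg.
  by rewrite (psumr_eq0P _ (esym G0)) ?ltxx.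
(* With this [c] the linear lower bounds [f i - c * g i] sum to zero. *)
set c := _ / _; have c0 : 0 < c by rewrite divr_gt0.
have cG : c * \sum_i g i = \sum_i f i by rewrite divfK ?gt_eqF.
rewrite -subr_ge0 mulr_suml -sumrB.
apply: le_trans (ler_sum _ (fun i _ => mul_ln_div_ge _ _ _ c0 (f0 i) (g0 i) (fg i))).
by rewrite sumrB -mulr_sumr cG subrr.
Qed.

(** The uniform distribution maximises entropy, in a form for any total mass: the log-sum inequality
    against the constant 1. *)
Lemma entropy_ge (I : finType) (f : I -> R) : (forall i, 0 <= f i) ->
  (\sum_i f i) * ln ((\sum_i f i) / #|I|%:R) <= \sum_i f i * ln (f i).
Proof.
move=> f0.
have := log_sum_ineq I f (fun=> 1) f0 (fun=> ler01) (fun _ _ => ltr01).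
by rewrite sumr_const; under [in leRHS]eq_bigr do rewrite divr1.
Qed.

Lemma mul_lnV x : 0 <= x -> x * ln x^-1 = - (x * ln x).
Proof.
rewrite le_eqVlt => /orP[/eqP<-|x0]; first by rewrite !mul0r oppr0.
by rewrite lnV ?posrE // mulrN.
Qed.

Lemma mul_ln_div x c : 0 <= x -> 0 < c -> x * ln (x / c) = x * ln x - x * ln c.
Proof.
rewrite le_eqVlt => /orP[/eqP<-|x0] c0; first by rewrite !mul0r subrr.
by rewrite ln_div ?posrE // mulrBr.
Qed.

Definition hln x : R := - x * ln x - (1 - x) * ln (1 - x).

Lemma h2E x : h2 x = hln x / ln 2.
Proof. by rewrite /h2 /log2 /hln !mulrA -mulrBl. Qed.

Lemma hln_ge0 x : 0 <= x <= 1 -> 0 <= hln x.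
Proof.
move=> /andP[x0 x1]; rewrite /hln.
have := ln_le0 x1; have /ln_le0 : 1 - x <= 1 by lra.
nra.
Qed.

(** Nonnegativity of the binary divergence gives [hln x <= - x * ln y - (1 - x) * ln (1 - y)]. The
    right side is affine in [x] with slope [ln (1 - y) - ln y > 0], and equals [hln y] at
    [x = y]. *)
Lemma hln_lt x y : 0 <= x -> x < y -> y < 1 / 2 -> hln x < hln y.
Proof.
move=> x0 xy y2; rewrite /hln.
have y0 : 0 < y by apply: le_lt_trans xy.
have y10 : 0 < 1 - y by lra.
have x10 : 0 <= 1 - x by lra.
have := mul_ln_div_ge x y 1 ltr01 x0 (ltW y0) (fun=> y0).
have := mul_ln_div_ge (1 - x) (1 - y) 1 ltr01 x10 (ltW y10) (fun=> y10).
rewrite ln1 !mulr0 !subr0 !mul1r !mul_ln_div //.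
have : ln y < ln (1 - y) by rewrite ltr_ln ?posrE //; lra.
nra.
Qed.
End LogSum.

(** * Mutual information for unnormalised inputs *)

Section Information.
Variables (R : realType) (X Y : finType) (W : channel R X Y).
Implicit Types (u v : X -> R) (x : X) (y : Y).

Definition output u y : R := \sum_x u x * W x y.

(** Separating the weight [u] from the input [v] that produces the output law makes this linear in
    [u]. When [0 <= u <= v] pointwise, every term of positive weight has a genuine quotient. *)
Definition cross_info u v : R :=
  \sum_x \sum_y u x * (W x y * ln (W x y / output v y)).

Definition info u : R := cross_info u u.

Lemma channel_informationE (p : distribution R X) :
  channel_information W p = info p / ln 2.
Proof.
rewrite /channel_information /mutual_information /info /cross_info mulr_suml.
apply: eq_bigr => x _; rewrite mulr_suml; apply: eq_bigr => y _ /=.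
have -> : marginal1 (input_output_distribution W p) x = p x.
  by rewrite /marginal1 /= -mulr_sumr prob_sum1 mulr1.
rewrite /log2 /marginal2 /= -/(output p y) !mulrA.
(* The factor [p x] cancels from the quotient only when it is nonzero; otherwise the weight
   vanishes. *)
have [->|px0] := eqVneq (p x) 0; first by rewrite !mul0r.
by rewrite -mulf_div divff // mul1r.
Qed.

Lemma output_ge0 u : (forall x, 0 <= u x) -> forall y, 0 <= output u y.
Proof. by move=> u0 y; apply: sumr_ge0 => x _; rewrite mulr_ge0 ?prob_ge0. Qed.

Lemma sum_output u : \sum_y output u y = \sum_x u x.
Proof.
rewrite exchange_big; apply: eq_bigr => x _.
by rewrite -mulr_sumr prob_sum1 mulr1.
Qed.

Lemma le_output u x y : (forall x, 0 <= u x) -> u x * W x y <= output u y.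
Proof.
move=> u0; rewrite /output (bigD1 x) //= lerDl.
by apply: sumr_ge0 => z _; rewrite mulr_ge0 ?prob_ge0.
Qed.

Lemma joint_gt0 u x y : (forall x, 0 <= u x) -> 0 < u x * W x y ->
  0 < W x y /\ 0 < output u y.
Proof.
move=> u0 uW; split; last exact: lt_le_trans uW (le_output _ _ _ u0).
by rewrite lt_neqAle prob_ge0 andbT; apply: contraTneq uW => <-; rewrite mulr0 ltxx.
Qed.

Lemma output_homo u v y : (forall x, u x <= v x) -> output u y <= output v y.
Proof. by move=> uv; apply: ler_sum => x _; rewrite ler_wpM2r ?prob_ge0. Qed.

(** A larger input has a larger output, which stands in the denominator of the logarithm. *)
Lemma cross_info_le u v : (forall x, 0 <= u x) -> (forall x, u x <= v x) ->
  cross_info u v <= info u.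
Proof.
move=> u0 uv; apply: ler_sum => x _; apply: ler_sum => y _; rewrite !mulrA.
have : 0 <= u x * W x y by rewrite mulr_ge0 ?prob_ge0.
rewrite le_eqVlt => /orP[/eqP<-|uW]; first by rewrite !mul0r.
have [W0 q0] := joint_gt0 u x y u0 uW.
have q1 : 0 < output v y := lt_le_trans q0 (output_homo _ _ _ uv).
rewrite ler_pM2l // ler_ln ?posrE ?divr_gt0 // ler_pM2l // lef_pV2 ?posrE //.
exact: output_homo.
Qed.

(** The difference of [cross_info u v] and [info u] is the divergence of [output u] from [output v];
    the log-sum inequality bounds it below through the total masses alone. *)
Lemma cross_info_ge u v : (forall x, 0 <= u x) -> (forall x, u x <= v x) ->
  info u + (\sum_x u x) * ln ((\sum_x u x) / (\sum_x v x)) <= cross_info u v.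
Proof.
move=> u0 uv.
have v0 x : 0 <= v x := le_trans (u0 x) (uv x).
have -> : cross_info u v =
    info u + \sum_y output u y * ln (output u y / output v y).
  under [X in _ + X]eq_bigr do rewrite mulr_suml.
  rewrite [X in _ + X]exchange_big -big_split; apply: eq_bigr => x _ /=.
  rewrite -big_split; apply: eq_bigr => y _ /=; rewrite !mulrA.
  have : 0 <= u x * W x y by rewrite mulr_ge0 ?prob_ge0.
  rewrite le_eqVlt => /orP[/eqP<-|uW]; first by rewrite !mul0r addr0.
  have [W0 q0] := joint_gt0 u x y u0 uW.
  have q1 : 0 < output v y := lt_le_trans q0 (output_homo _ _ _ uv).
  rewrite !ln_div ?posrE //; ring.
rewrite lerD2l -!sum_output; apply: log_sum_ineq; try exact: output_ge0.
by move=> y /lt_le_trans; apply; apply: output_homo.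
Qed.

(** For each [x] with [u x > 0], the log-sum inequality compares the row [W x], of mass 1, with
    [output u], of the mass of [u]. *)
Lemma info_ge u : (forall x, 0 <= u x) ->
  - ((\sum_x u x) * ln (\sum_x u x)) <= info u.
Proof.
move=> u0; rewrite -mul_lnV ?sumr_ge0 // mulr_suml; apply: ler_sum => x _.
rewrite -mulr_sumr; have := u0 x.
rewrite le_eqVlt => /orP[/eqP<-|ux]; first by rewrite !mul0r.
rewrite ler_pM2l //.
have := log_sum_ineq _ _ (W x) (output u) (@prob_ge0 _ _ _) (output_ge0 _ u0).
rewrite prob_sum1 sum_output !mul1r; apply => y Wxy.
by apply: lt_le_trans (le_output _ x y u0); rewrite mulr_gt0.
Qed.

(** Since [W x y <= 1], the information is at most the entropy of the output, to which [entropy_ge]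
    applies. *)
Lemma info_le_card_output u : (forall x, 0 <= u x) ->
  info u <= - ((\sum_x u x) * ln ((\sum_x u x) / #|Y|%:R)).
Proof.
move=> u0; rewrite lerNr -sum_output.
apply: le_trans (entropy_ge _ _ _ (output_ge0 _ u0)) _.
rewrite lerNr /info /cross_info exchange_big /= -sumrN; apply: ler_sum => y _.
have -> : output u y * ln (output u y) = \sum_x u x * W x y * ln (output u y).
  by rewrite -mulr_suml.
rewrite -sumrN; apply: ler_sum => x _; rewrite mulrA -mulrN.
have : 0 <= u x * W x y by rewrite mulr_ge0 ?prob_ge0.
rewrite le_eqVlt => /orP[/eqP<-|uW]; first by rewrite !mul0r.
have [W0 q0] := joint_gt0 u x y u0 uW.
rewrite ler_pM2l // ln_div ?posrE // gerDr ln_le0 //.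
by rewrite -(prob_sum1 (W x)) (bigD1 y) //= lerDl sumr_ge0 // => z _; rewrite prob_ge0.
Qed.

(** Since [u x * W x y <= output u y], each logarithm is at most [- ln (u x)], so the information is
    at most the entropy of the input. *)
Lemma info_le_card_input u : (forall x, 0 <= u x) ->
  info u <= - ((\sum_x u x) * ln ((\sum_x u x) / #|X|%:R)).
Proof.
move=> u0; rewrite lerNr; apply: le_trans (entropy_ge _ _ _ u0) _.
rewrite lerNr -sumrN; apply: ler_sum => x _.
have -> : - (u x * ln (u x)) = \sum_y u x * (W x y * - ln (u x)).
  by rewrite -mulr_sumr -mulr_suml prob_sum1 mul1r mulrN.
apply: ler_sum => y _; rewrite !mulrA.
have : 0 <= u x * W x y by rewrite mulr_ge0 ?prob_ge0.
rewrite le_eqVlt => /orP[/eqP<-|uW]; first by rewrite !mul0r.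
have [W0 q0] := joint_gt0 u x y u0 uW.
have ux : 0 < u x by rewrite -(pmulr_lgt0 _ W0).
rewrite ler_pM2l // -lnV ?posrE // ler_ln ?posrE ?divr_gt0 ?invr_gt0 //.
by rewrite ler_pdivrMr // ler_pdivlMl // le_output.
Qed.

(** One-sided, because exchanging [p] and [q] gives the other side; [N] abstracts the choice between
    the two cardinality bounds. *)
Lemma info_distribution_sub_le (p q : distribution R X) (t N : R) :
  \sum_x `|q x - p x| = 2 * t -> 0 < N ->
  (forall u, (forall x, 0 <= u x) ->
     info u <= - ((\sum_x u x) * ln ((\sum_x u x) / N))) ->
  info q - info p <= t * ln N + hln R t.
Proof.
move=> dist N0 info_le.
pose m x := Num.min (p x) (q x).
pose a x := p x - m x; pose b x := q x - m x.
have m0 x : 0 <= m x by rewrite le_min !prob_ge0.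
have mp x : m x <= p x by rewrite ge_min lexx.
have mq x : m x <= q x by rewrite ge_min lexx orbT.
have a0 x : 0 <= a x by rewrite subr_ge0.
have b0 x : 0 <= b x by rewrite subr_ge0.
have ap x : a x <= p x by rewrite gerDl oppr_le0.
have bq x : b x <= q x by rewrite gerDl oppr_le0.
(* At each [x] one of [a x], [b x] is zero and the other is the absolute difference. *)
have sum_ab : \sum_x a x + \sum_x b x = 2 * t.
  rewrite -dist -big_split; apply: eq_bigr => x _ /=; rewrite /a /b /m.
  by case: leP => pq; [rewrite ger0_norm|rewrite ltr0_norm]; lra.
have sum_a : \sum_x a x = 1 - \sum_x m x by rewrite sumrB prob_sum1.
have sum_b : \sum_x b x = 1 - \sum_x m x by rewrite sumrB prob_sum1.
have {}sum_a : \sum_x a x = t by lra.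
have {}sum_b : \sum_x b x = t by lra.
have sum_m : \sum_x m x = 1 - t.
  by rewrite -sum_a sumrB prob_sum1; lra.
have t0 : 0 <= t by rewrite -sum_a sumr_ge0.
have split u v w : (forall x, v x = u x - w x) ->
    info u = cross_info w u + cross_info v u.
  move=> vE; rewrite -big_split; apply: eq_bigr => x _ /=.
  rewrite -big_split; apply: eq_bigr => y _ /=; rewrite vE; ring.
have := split p a m (fun=> erefl); have := split q b m (fun=> erefl).
have := cross_info_le m q m0 mq; have := cross_info_le b q b0 bq.
have := cross_info_ge m p m0 mp; have := cross_info_ge a p a0 ap.
have := info_ge a a0; have := info_le b b0.
(* [info m] cancels between the upper bound on [info q] and the lower bound on [info p]. The entropy
   term [- t * ln t] of [info b] cancels against that of [info a], which leaves [t * ln N] and the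
   splitting loss [hln t]. *)
rewrite prob_sum1 !divr1 sum_a sum_b sum_m mul_ln_div // /hln; lra.
Qed.
End Information.

(** * From the one-sided estimate to the two stated bounds *)

Lemma natr_card_ge1 (R : realType) (I : finType) (p : distribution R I) :
  1 <= #|I|%:R :> R.
Proof.
rewrite ler1n lt0n; apply/negP => /eqP/card0_eq I0.
by have /eqP := prob_sum1 p; rewrite big_pred0 // eq_sym oner_eq0.
Qed.

Theorem proposition5 (R : realType) (X Y : finType) (W : channel R X Y)
    (delta : R) (p pstar : distribution R X)
    (hdelta0 : 0 < delta) (hdelta1 : delta < 1 / 8%:R)
    (hdist : 1 / 2%:R * (\sum_(x : X) `|pstar x - p x|) < delta) :
  `|channel_information W pstar - channel_information W p|
    < 3%:R * delta * log2 (#|Y|%:R) + h2 delta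
  /\
  `|channel_information W pstar - channel_information W p|
    < 7%:R * delta * log2 (#|X|%:R) + h2 delta + h2 (4%:R * delta).
Proof.
set t := 1 / 2%:R * _ in hdist.
have t0 : 0 <= t by rewrite mulr_ge0 ?divr_ge0 ?sumr_ge0.
have dist : \sum_x `|pstar x - p x| = 2 * t by rewrite /t; lra.
have dist' : \sum_x `|p x - pstar x| = 2 * t.
  by rewrite -dist; apply: eq_bigr => x _; rewrite distrC.
(* Both claims follow from this bound, at [N = #|Y|] and [N = #|X|]. It is strict because [hln] is
   strictly increasing on the range containing [t < delta]. *)
have bound N (N1 : 1 <= N) (info_le : forall u : X -> R, (forall x, 0 <= u x) ->
    info R X Y W u <= - ((\sum_x u x) * ln ((\sum_x u x) / N))) :
    `|channel_information W pstar - channel_information W p|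
      < delta * log2 N + h2 delta.
  have N0 : 0 < N := lt_le_trans ltr01 N1.
  rewrite !channel_informationE h2E /log2 mulrA -mulrBl -mulrDl.
  have ln2 : 0 < ln 2 :> R by rewrite ln_gt0 // ltr1n.
  rewrite normrM [ `|_^-1|]gtr0_norm ?invr_gt0 // ltr_pM2r ?invr_gt0 //.
  have le1 := info_distribution_sub_le _ _ _ _ p pstar t N dist N0 info_le.
  have le2 := info_distribution_sub_le _ _ _ _ pstar p t N dist' N0 info_le.
  have hlt : hln R t < hln R delta by apply: hln_lt; lra.
  have lnN : 0 <= ln N by apply: ln_ge0.
  have : t * ln N <= delta * ln N by rewrite ler_wpM2r // ltW.
  rewrite ltr_norml; lra.
have log2_ge0 (N : R) : 1 <= N -> 0 <= log2 N.
  by move=> N1; rewrite divr_ge0 ?ln_ge0 // ler1n.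
(* An input letter is needed to exhibit a distribution on [Y], namely [W x], and so [1 <= #|Y|]. *)
have [x _] : exists x : X, true.
  have := natr_card_ge1 _ _ p; rewrite ler1n => /card_gt0P[x _]; by exists x.
have cardY := natr_card_ge1 _ _ (W x); have cardX := natr_card_ge1 _ _ p.
have := bound _ cardY (info_le_card_output _ _ _ W).
have := bound _ cardX (info_le_card_input _ _ _ W).
have : 0 <= h2 (4%:R * delta).
  by rewrite h2E divr_ge0 ?ln_ge0 ?ler1n // hln_ge0 //; lra.
have := mulr_ge0 (ltW hdelta0) (log2_ge0 _ cardY).
have := mulr_ge0 (ltW hdelta0) (log2_ge0 _ cardX).
split; lra.
Qed.
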